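(* Let $(H,\mu_H,\Delta_H,\alpha_H,1_H,\varepsilon_H,S)$ be a Hom-Hopf algebra over a field $k$ with bijective antipode $S$, and let $(D,\mu_D,\alpha_D)$ be an $H$-bimodule Hom-algebra, with actions $h\otimes d\mapsto h\cdot d$ and $d\otimes h\mapsto d\cdot h$, such that $\alpha_D$ and $\alpha_H$ are both bijective and $1_H\cdot d=d\cdot 1_H=\alpha_D(d)$ for all $d\in D$. Then the map $$Q:D\otimes H\to D\otimes H,\quad Q(d\otimes h)=\alpha_D^{-1}(d)\cdot\alpha_H^{-2}(h_2)\otimes\alpha_H^{-1}(h_1)$$ is bijective, with inverse $$Q^{-1}:D\otimes H\to D\otimes H,\quad Q^{-1}(d\otimes h)=\alpha_D^{-1}(d)\cdot\alpha_H^{-2}(S^{-1}(h_2))\otimes\alpha_H^{-1}(h_1).$$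
   Context: Everything is over a field $k$. Sweedler notation $\Delta(h)=h_1\otimes h_2$. A Hom-associative algebra is a triple $(A,\mu,\alpha)$ with $\mu:A\otimes A\to A$ (written $aa'$) and $\alpha:A\to A$ linear (the structure map) such that $\alpha(aa')=\alpha(a)\alpha(a')$ and $\alpha(a)(a'a'')=(aa')\alpha(a'')$. A Hom-bialgebra $(H,\mu,\Delta,\alpha)$ is a Hom-associative algebra with a linear map $\Delta:H\to H\otimes H$ such that $\Delta(h_1)\otimes\alpha(h_2)=\alpha(h_1)\otimes\Delta(h_2)$, $\Delta(hh')=h_1h'_1\otimes h_2h'_2$, $\Delta(\alpha(h))=\alpha(h_1)\otimes\alpha(h_2)$. A Hom-Hopf algebra $(H,\mu_H,\Delta_H,\alpha_H,1_H,\varepsilon_H,S)$ is a Hom-bialgebra with an element $1_H\in H$ and linear maps $\varepsilon_H:H\to k$, $S:H\to H$ (antipode) such that: $\alpha_H(1_H)=1_H$, $1_Hh=h1_H=\alpha_H(h)$; $\varepsilon_H\circ\alpha_H=\varepsilon_H$, $\varepsilon_H(h_1)h_2=h_1\varepsilon_H(h_2)=\alpha_H(h)$; $\Delta_H(1_H)=1_H\otimes1_H$; $\varepsilon_H(hh')=\varepsilon_H(h)\varepsilon_H(h')$; $\varepsilon_H(1_H)=1$; $S(h_1)h_2=h_1S(h_2)=\varepsilon_H(h)1_H$; $S\circ\alpha_H=\alpha_H\circ S$. An $H$-bimodule Hom-algebra is a Hom-associative algebra $(D,\mu_D,\alpha_D)$ (not assumed unital) with linear actions of $H$ such that: $\alpha_D(h\cdot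 d)=\alpha_H(h)\cdot\alpha_D(d)$; $\alpha_H(h)\cdot(h'\cdot d)=(hh')\cdot\alpha_D(d)$; $\alpha_D(d\cdot h)=\alpha_D(d)\cdot\alpha_H(h)$; $(d\cdot h)\cdot\alpha_H(h')=\alpha_D(d)\cdot(hh')$; $\alpha_H(h)\cdot(d\cdot h')=(h\cdot d)\cdot\alpha_H(h')$; $\alpha_H^2(h)\cdot(dd')=(h_1\cdot d)(h_2\cdot d')$; $(dd')\cdot\alpha_H^2(h)=(d\cdot h_1)(d'\cdot h_2)$. *)

(* Defs.v *)
From HB Require Import structures.
From mathcomp Require Import all_boot all_order all_algebra.
From mathcomp Require Import sesquilinear generic_quotient.
From mathcomp Require Import boolp.

Set Implicit Arguments.
Unset Strict Implicit.
Unset Printing Implicit Defensive.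

Import GRing.Theory.
Local Open Scope ring_scope.
Local Open Scope quotient_scope.

Reserved Notation "v \ox w" (at level 40, left associativity).
Reserved Notation "\sw_ ( x , y <- X ) F"
  (at level 41, F at level 41, X at level 200, x name, y name,
   format "'[' \sw_ ( x ,  y  <-  X ) '/  '  F ']'").

(* The algebraic tensor product of two vector spaces, of any dimension: the    *)
(* finite formal sums of pairs (v, w), represented by lists of pairs, modulo   *)
(* the congruence generated by bilinearity. Opposites need no formal           *)
(* counterpart, as (- v, w) is an opposite of (v, w) in the quotient.          *)
Section TensorProduct.
Variables (K : fieldType) (V W : lmodType K).
Implicit Types (s t : seq (V * W)) (v : V) (w : W) (a : K).

Inductive tens_eq : seq (V * W) -> seq (V * W) -> Prop :=
| TensRefl s : tens_eq s s
| TensSym s t : tens_eq s t -> tens_eq t s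
| TensTrans s t u : tens_eq s t -> tens_eq t u -> tens_eq s u
| TensCat s s' t t' : tens_eq s s' -> tens_eq t t' -> tens_eq (s ++ t) (s' ++ t')
| TensCatC s t : tens_eq (s ++ t) (t ++ s)
| Tens0 w : tens_eq [:: (0, w)] [::]
| TensDl v v' w : tens_eq [:: (v + v', w)] [:: (v, w); (v', w)]
| TensDr v w w' : tens_eq [:: (v, w + w')] [:: (v, w); (v, w')]
| TensZ a v w : tens_eq [:: (a *: v, w)] [:: (v, a *: w)].

Definition tens_eqb s t : bool := `[< tens_eq s t >].

Lemma tens_eqb_refl : reflexive tens_eqb.
Proof. by move=> s; apply/asboolP; apply: TensRefl. Qed.

Lemma tens_eqb_sym : symmetric tens_eqb.
Proof. by move=> s t; apply/asboolP/asboolP => /TensSym. Qed.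

Lemma tens_eqb_trans : transitive tens_eqb.
Proof. by move=> t s u /asboolP st /asboolP tu; apply/asboolP/(TensTrans st). Qed.

Canonical tens_equiv := EquivRel tens_eqb tens_eqb_refl tens_eqb_sym tens_eqb_trans.

Definition tensor := {eq_quot tens_equiv}.
HB.instance Definition _ := Choice.on tensor.
HB.instance Definition _ := Quotient.on tensor.

Definition tpi (s : seq (V * W)) : tensor := \pi_tensor s.

Lemma tpiP s t : tpi s = tpi t <-> tens_eq s t.
Proof. by split=> [/eqmodP/asboolP//|st]; apply/eqmodP/asboolP. Qed.

Lemma repr_tpi s : tens_eq (repr (tpi s)) s.
Proof. by apply/tpiP; rewrite /tpi reprK. Qed.

Lemma tpiK (x : tensor) : tpi (repr x) = x.
Proof. by rewrite /tpi reprK. Qed.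

Definition tadd (x y : tensor) : tensor := tpi (repr x ++ repr y).
Definition tscale a (x : tensor) : tensor :=
  tpi [seq (a *: p.1, p.2) | p <- repr x].
Definition topp (x : tensor) : tensor := tscale (-1) x.

Lemma tadd_tpi s t : tadd (tpi s) (tpi t) = tpi (s ++ t).
Proof. by apply/tpiP; apply: TensCat; apply: repr_tpi. Qed.

Lemma tpi_cons p s : tpi (p :: s) = tadd (tpi [:: p]) (tpi s).
Proof. by rewrite tadd_tpi. Qed.

Lemma tens_eq_scale a s t : tens_eq s t ->
  tens_eq [seq (a *: p.1, p.2) | p <- s] [seq (a *: p.1, p.2) | p <- t].
Proof.
elim=> {s t} /=.
- by move=> s; apply: TensRefl.
- by move=> s t _; apply: TensSym.
- by move=> s t u _ st _; apply: TensTrans.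
- by move=> s s' t t' _ ss' _ tt'; rewrite !map_cat; apply: TensCat.
- by move=> s t; rewrite !map_cat; apply: TensCatC.
- by move=> w; rewrite scaler0; apply: Tens0.
- by move=> v v' w; rewrite scalerDr; apply: TensDl.
- by move=> v w w'; apply: TensDr.
- by move=> b v w; rewrite scalerA mulrC -scalerA; apply: TensZ.
Qed.

Lemma tscale_tpi a s : tscale a (tpi s) = tpi [seq (a *: p.1, p.2) | p <- s].
Proof. by apply/tpiP/tens_eq_scale/repr_tpi. Qed.

Lemma tpi_surj (x : tensor) : exists s, x = tpi s.
Proof. by exists (repr x); rewrite tpiK. Qed.

Lemma taddA : associative tadd.
Proof.
move=> x y z; have [s ->] := tpi_surj x; have [t ->] := tpi_surj y.
by have [u ->] := tpi_surj z; rewrite !tadd_tpi catA.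
Qed.

Lemma taddC : commutative tadd.
Proof.
move=> x y; have [s ->] := tpi_surj x; have [t ->] := tpi_surj y.
by rewrite !tadd_tpi; apply/tpiP/TensCatC.
Qed.

Lemma tadd0 : left_id (tpi [::]) tadd.
Proof. by move=> x; have [s ->] := tpi_surj x; rewrite tadd_tpi. Qed.

Lemma tscale_addl a b x : tscale (a + b) x = tadd (tscale a x) (tscale b x).
Proof.
have [s ->] := tpi_surj x; rewrite !tscale_tpi tadd_tpi.
rewrite -tadd_tpi; elim: s => [|[v w] s IHs] /=; first by rewrite tadd0.
rewrite tpi_cons IHs (tpi_cons (a *: v, w)) (tpi_cons (b *: v, w)) scalerDl.
have -> : tpi [:: (a *: v + b *: v, w)]
        = tadd (tpi [:: (a *: v, w)]) (tpi [:: (b *: v, w)]).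
  by rewrite tadd_tpi; apply/tpiP/TensDl.
rewrite !taddA; congr tadd; rewrite -!taddA; congr tadd; exact: taddC.
Qed.

Lemma tscale0 x : tscale 0 x = tpi [::].
Proof.
have [s ->] := tpi_surj x; rewrite tscale_tpi.
elim: s => [|[v w] s IHs] //=; rewrite tpi_cons IHs scale0r.
by rewrite taddC tadd0; apply/tpiP/Tens0.
Qed.

Lemma tscale1 : left_id 1 tscale.
Proof.
move=> x; have [s ->] := tpi_surj x; rewrite tscale_tpi; congr tpi.
by rewrite -[RHS]map_id; apply: eq_map => -[v w]; rewrite scale1r.
Qed.

Lemma tadd_opp : left_inverse (tpi [::]) topp tadd.
Proof. by move=> x; rewrite -{2}[x]tscale1 -tscale_addl addNr tscale0. Qed.

HB.instance Definition _ :=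
  GRing.isZmodule.Build tensor taddA taddC tadd0 tadd_opp.

Lemma tscaleA a b x : tscale a (tscale b x) = tscale (a * b) x.
Proof.
have [s ->] := tpi_surj x; rewrite !tscale_tpi -map_comp; congr tpi.
by apply: eq_map => -[v w] /=; rewrite scalerA.
Qed.

Lemma tscale_addr : right_distributive tscale +%R.
Proof.
move=> a x y; have [s ->] := tpi_surj x; have [t ->] := tpi_surj y.
by rewrite /GRing.add /= tadd_tpi !tscale_tpi tadd_tpi map_cat.
Qed.

Lemma tscale_addl_add x : {morph tscale^~ x : a b / a + b}.
Proof. by move=> a b; apply: tscale_addl. Qed.

HB.instance Definition _ :=
  GRing.Zmodule_isLmodule.Build K tensor tscaleA tscale1 tscale_addr
    tscale_addl_add.

Definition tens v w : tensor := tpi [:: (v, w)].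

Lemma tens_bilinear : bilinear_for *:%R *:%R tens.
Proof.
split=> [w a v v'|v a w w'] /=.
  rewrite {1}/tens; have -> : a *: tens v w = tens (a *: v) w.
    exact: (tscale_tpi a [:: (v, w)]).
  rewrite /GRing.add /= tadd_tpi; exact/tpiP/TensDl.
have -> : a *: tens v w = tens v (a *: w).
  by rewrite [LHS](tscale_tpi a [:: (v, w)]); apply/tpiP/TensZ.
rewrite /GRing.add /= tadd_tpi; exact/tpiP/TensDr.
Qed.

HB.instance Definition _ :=
  bilinear_isBilinear.Build K V W tensor *:%R *:%R tens tens_bilinear.

Lemma tensor_sum (x : tensor) : x = \sum_(p <- repr x) tens p.1 p.2.
Proof.
rewrite -{1}[x]tpiK; elim: (repr x) => [|[v w] s IHs]; first by rewrite big_nil.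
by rewrite big_cons -IHs /= -cat1s -tadd_tpi.
Qed.

End TensorProduct.

Notation "v \ox w" := (tens v w) : ring_scope.

(* Sweedler notation. If x is the sum of the v_i \ox w_i, then                 *)
(* \sw_(v, w <- x) f v w is the sum of the f v_i w_i. It is defined through a  *)
(* chosen representative of x, on which it does not depend when f is bilinear: *)
(* see tsum_bilinear, tsum_linear and tsum_tens.                               *)
Definition tsum (K : fieldType) (V W : lmodType K) (T : zmodType)
    (x : tensor V W) (f : V -> W -> T) : T :=
  \sum_(p <- repr x) f p.1 p.2.

Notation "\sw_ ( x , y <- X ) F" := (tsum X (fun x y => F)) : ring_scope.

Section TensorTheory.
Variables (K : fieldType) (V W T : lmodType K).

Lemma tens_eq_sum (f : {bilinear V -> W -> T}) s t : tens_eq s t ->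
  \sum_(p <- s) f p.1 p.2 = \sum_(p <- t) f p.1 p.2.
Proof.
elim=> {s t} //=.
- by move=> s t u _ -> _ ->.
- by move=> s s' t t' _ ss' _ tt'; rewrite !big_cat ss' tt'.
- by move=> s t; rewrite !big_cat /= addrC.
- by move=> w; rewrite big_cons !big_nil addr0 linear0l.
- by move=> v v' w; rewrite !big_cons !big_nil !addr0 linearDl.
- by move=> v w w'; rewrite !big_cons !big_nil !addr0 linearDr.
- by move=> a v w; rewrite !big_cons !big_nil !addr0 linearZl_LR linearZr_LR.
Qed.

Lemma tsum_bilinear (f : {bilinear V -> W -> T}) s :
  tsum (\sum_(p <- s) p.1 \ox p.2) f = \sum_(p <- s) f p.1 p.2.
Proof.
apply: tens_eq_sum; have -> : \sum_(p <- s) p.1 \ox p.2 = tpi s.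
  elim: s => [|[v w] s IHs]; first by rewrite big_nil.
  by rewrite big_cons IHs -cat1s -tadd_tpi.
exact: repr_tpi.
Qed.

Lemma tsum_tens (f : {bilinear V -> W -> T}) v w : tsum (v \ox w) f = f v w.
Proof. by have := tsum_bilinear f [:: (v, w)]; rewrite !big_seq1. Qed.

Lemma tsum_linear (f : {bilinear V -> W -> T}) :
  linear (fun x : tensor V W => tsum x f).
Proof.
move=> a x y; rewrite {1}[x]tensor_sum {1}[y]tensor_sum scaler_sumr.
have -> : \sum_(p <- repr x) a *: (p.1 \ox p.2) =
    \sum_(p <- [seq (a *: p.1, p.2) | p <- repr x]) p.1 \ox p.2.
  by rewrite big_map; apply: eq_bigr => p _; rewrite -linearZl_LR.
rewrite -big_cat tsum_bilinear big_cat big_map /=; congr (_ + _).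
by rewrite /tsum scaler_sumr; apply: eq_bigr => p _; rewrite linearZl_LR.
Qed.

Lemma tensor_ext (f g : {linear tensor V W -> T}) :
  (forall v w, f (v \ox w) = g (v \ox w)) -> f =1 g.
Proof.
move=> fg x; rewrite [x]tensor_sum !linear_sum.
by apply: eq_bigr => p _; apply: fg.
Qed.

End TensorTheory.

HB.mixin Record isHomAssociative (K : fieldType) A of GRing.Lmodule K A := {
  hmul : {bilinear A -> A -> A};
  halpha : {linear A -> A};
  halphaM : forall a b : A, halpha (hmul a b) = hmul (halpha a) (halpha b);
  hmulA : forall a b c : A,
    hmul (halpha a) (hmul b c) = hmul (hmul a b) (halpha c)
}.

#[short(type="homAssocType")]
HB.structure Definition HomAssociative (K : fieldType) :=
  { A of GRing.Lmodule K A & isHomAssociative K A }.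

(* The two sides of hcoassoc live in H \ox (H \ox H), into which               *)
(* (H \ox H) \ox H is moved by the usual associativity isomorphism.            *)
HB.mixin Record isHomBialgebra (K : fieldType) H of HomAssociative K H := {
  hdelta : {linear H -> tensor H H};
  hcoassoc : forall h : H,
    \sw_(h1, h2 <- hdelta h) \sw_(h11, h12 <- hdelta h1)
       h11 \ox (h12 \ox (halpha h2 : H))
    = \sw_(h1, h2 <- hdelta h) (halpha h1 : H) \ox hdelta h2;
  hdeltaM : forall h g : H,
    hdelta (hmul h g) =
    \sw_(h1, h2 <- hdelta h) \sw_(g1, g2 <- hdelta g)
       (hmul h1 g1 : H) \ox (hmul h2 g2 : H);
  hdelta_alpha : forall h : H,
    hdelta (halpha h) =
    \sw_(h1, h2 <- hdelta h) (halpha h1 : H) \ox (halpha h2 : H)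
}.

#[short(type="homBialgType")]
HB.structure Definition HomBialgebra (K : fieldType) :=
  { H of HomAssociative K H & isHomBialgebra K H }.

HB.mixin Record isHomHopf (K : fieldType) H of HomBialgebra K H := {
  hone : H;
  hcounit : {scalar H};
  hantipode : {linear H -> H};
  halpha1 : halpha hone = hone :> H;
  hmul1l : forall h : H, hmul hone h = halpha h :> H;
  hmul1r : forall h : H, hmul h hone = halpha h :> H;
  hcounit_alpha : forall h : H, hcounit (halpha h) = hcounit h;
  hcounitl : forall h : H,
    \sw_(h1, h2 <- hdelta h) (hcounit h1 *: h2) = halpha h :> H;
  hcounitr : forall h : H,
    \sw_(h1, h2 <- hdelta h) (hcounit h2 *: h1) = halpha h :> H;
  hdelta1 : hdelta hone = hone \ox hone;
  hcounitM : forall h g : H, hcounit (hmul h g) = hcounit h * hcounit g;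
  hcounit1 : hcounit hone = 1;
  hantipodel : forall h : H,
    \sw_(h1, h2 <- hdelta h) hmul (hantipode h1) h2 = hcounit h *: hone :> H;
  hantipoder : forall h : H,
    \sw_(h1, h2 <- hdelta h) hmul h1 (hantipode h2) = hcounit h *: hone :> H;
  hantipode_alpha : forall h : H,
    hantipode (halpha h) = halpha (hantipode h) :> H
}.

#[short(type="homHopfType")]
HB.structure Definition HomHopf (K : fieldType) :=
  { H of HomBialgebra K H & isHomHopf K H }.

HB.mixin Record isBimoduleHomAlgebra (K : fieldType) (H : homBialgType K) D
    of HomAssociative K D := {
  lact : {bilinear H -> D -> D};
  ract : {bilinear D -> H -> D};
  lact_alpha : forall (h : H) (d : D),
    halpha (lact h d) = lact (halpha h) (halpha d) :> D;
  lactA : forall (h g : H) (d : D),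
    lact (halpha h) (lact g d) = lact (hmul h g) (halpha d) :> D;
  ract_alpha : forall (d : D) (h : H),
    halpha (ract d h) = ract (halpha d) (halpha h) :> D;
  ractA : forall (d : D) (h g : H),
    ract (ract d h) (halpha g) = ract (halpha d) (hmul h g) :> D;
  lractA : forall (h g : H) (d : D),
    lact (halpha h) (ract d g) = ract (lact h d) (halpha g) :> D;
  lactM : forall (h : H) (d e : D),
    lact (halpha (halpha h)) (hmul d e) =
    \sw_(h1, h2 <- hdelta h) hmul (lact h1 d) (lact h2 e) :> D;
  ractM : forall (d e : D) (h : H),
    ract (hmul d e) (halpha (halpha h)) =
    \sw_(h1, h2 <- hdelta h) hmul (ract d h1) (ract e h2) :> D
}.

#[short(type="bimodHomAlgType")]
HB.structure Definition BimoduleHomAlgebra (K : fieldType) (H : homBialgType K) :=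
  { D of HomAssociative K D & isBimoduleHomAlgebra K H D }.

(* Main.v *)
Require Import Defs.
From HB Require Import structures.
From mathcomp Require Import all_boot all_order all_algebra.
From mathcomp Require Import sesquilinear generic_quotient.

(* As the structure maps are bijective, composing every operation with their *)
(* inverses untwists H into an ordinary Hopf algebra, with product           *)
(* x ** y = alpha^-1 (x y) and coproduct h |-> Delta (alpha^-1 h), and D     *)
(* into an ordinary right module over it, with d <** h = alpha^-1 (d . h).   *)
(* The two maps become d \ox h |-> d <** th h2 \ox h1 with th = id and       *)
(* th = S^-1, and they are inverse to each other because S^-1 is an antipode *)
(* for the opposite coproduct: S^-1 (h2) ** h1 = h2 ** S^-1 (h1) = eps h.    *)

Set Implicit Arguments.
Unset Strict Implicit.
Unset Printing Implicit Defensive.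

Import GRing.Theory.
Local Open Scope ring_scope.

(** Write Q_th for the map d \ox h |-> d <** th h2 \ox h1 ([twist]). By the module law and
    coassociativity, Q_th after Q_ph sends d \ox h to d <** (ph h3 ** th h2) \ox h1, which is d \ox
    h as soon as ph h2 ** th h1 = eps h ([twist_cancel]). For {th, ph} = {id, S^-1} these are the
    two skew-antipode identities. They come from the antipode axioms by applying the injective map
    S, which reverses products ([hantipodeM]) and fixes the unit. The rest is the untwisting,
    chiefly [udelta_coassoc], [umulA] and [uractA]. *)

Local Notation bilinear f := (bilinear_for *:%R *:%R f).

(** * Multilinearity of Sweedler sums *)

Section MultilinearMaps.
Variable K : fieldType.
Implicit Types U V W T : lmodType K.

Lemma linear_idfun V : linear (fun v : V => v).
Proof. by []. Qed.

Lemma linear_app U V W (f : V -> W) (g : U -> V) :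
  linear f -> linear g -> linear (fun u => f (g u)).
Proof. by move=> fL gL a u u'; rewrite gL fL. Qed.

Lemma linear_map U V W (f : {linear V -> W}) (g : U -> V) :
  linear g -> linear (fun u => f (g u)).
Proof. by apply: linear_app; apply: linearP. Qed.

Lemma linear_bilinearl U V V' W (f : {bilinear V -> V' -> W}) (g : U -> V) v :
  linear g -> linear (fun u => f (g u) v).
Proof. by move=> gL a u u'; rewrite gL linearPl. Qed.

Lemma linear_bilinearr U V V' W (f : {bilinear V -> V' -> W}) (g : U -> V') v :
  linear g -> linear (fun u => f v (g u)).
Proof. by move=> gL a u u'; rewrite gL linearPr. Qed.

(** Here the tensor is fixed and only the summand varies, so one representative serves throughout;
    when the tensor varies, as in [linear_tsum_tensor], bilinearity of the summand makes the choice
    immaterial. *)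
Lemma linear_tsum U V W T (t : tensor V W) (f : U -> V -> W -> T) :
  (forall v w, linear (fun u => f u v w)) -> linear (fun u => tsum t (f u)).
Proof.
move=> fL a u u'; rewrite /tsum scaler_sumr -big_split.
by apply: eq_bigr => p _; apply: fL.
Qed.

Definition bundle_bilinear V W T (f : V -> W -> T) (fB : bilinear f) :
  {bilinear V -> W -> T} :=
  HB.pack f (bilinear_isBilinear.Build K V W T *:%R *:%R f fB).

Lemma tsum_pure V W T (f : V -> W -> T) v w :
  bilinear f -> tsum (v \ox w) f = f v w.
Proof. by move=> fB; apply: (tsum_tens (bundle_bilinear fB)). Qed.

Lemma linear_tsum_tensor U V W T (f : V -> W -> T) (g : U -> tensor V W) :
  bilinear f -> linear g -> linear (fun u => tsum (g u) f).
Proof.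
by move=> fB gL; apply: linear_app (tsum_linear (bundle_bilinear fB)) gL.
Qed.

Definition bundle_linear V W (f : V -> W) (fL : linear f) : {linear V -> W} :=
  HB.pack f (GRing.isLinear.Build K V W *:%R f fL).

Lemma linear_homogeneous V W (f : V -> W) a v :
  linear f -> f (a *: v) = a *: f v.
Proof. by move=> fL; apply: (linearZ_LR (bundle_linear fL)). Qed.

Lemma linear_of_tsum V W U T (f : U -> T) (t : tensor V W) (g : V -> W -> U) :
  linear f -> f (tsum t g) = tsum t (fun v w => f (g v w)).
Proof.
move=> fL.
exact: (linear_sum (bundle_linear fL) _ _ (fun p => g p.1 p.2)).
Qed.

Lemma tsum_tsum V W V' W' T (t : tensor V W) (g : V -> W -> tensor V' W')
    (f : V' -> W' -> T) :
  bilinear f -> tsum (tsum t g) f = tsum t (fun v w => tsum (g v w) f).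
Proof.
move=> fB; rewrite (linear_of_tsum (f := fun x => tsum x f)) //.
exact: linear_tsum_tensor.
Qed.

Lemma eq_tsum V W T (t : tensor V W) (f g : V -> W -> T) :
  (forall v w, f v w = g v w) -> tsum t f = tsum t g.
Proof. by move=> fg; apply: eq_bigr. Qed.

Lemma tsum_exchange V W V' W' T (t : tensor V W) (t' : tensor V' W')
    (f : V -> W -> V' -> W' -> T) :
  \sw_(v, w <- t) \sw_(v', w' <- t') f v w v' w'
  = \sw_(v', w' <- t') \sw_(v, w <- t) f v w v' w'.
Proof. exact: exchange_big. Qed.

Lemma linear_can V W (f : {linear V -> W}) (g : W -> V) :
  cancel f g -> cancel g f -> linear g.
Proof. by move=> fK gK a w w'; apply: (can_inj fK); rewrite linearP !gK. Qed.

End MultilinearMaps.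

(** Splits bilinearity into its one-variable parts, then peels off the outermost operation until the
    variable itself is reached. *)
Ltac multilinear :=
  solve [repeat (intros; lazymatch goal with
  | |- bilinear_for _ _ _ => split; move=> ? /=
  | |- _ => first [ assumption | exact: linear_idfun | apply: linear_tsum
    | apply: linear_tsum_tensor | apply: linear_bilinearl
    | apply: linear_bilinearr | apply: linear_map
    | apply: linear_app; [assumption|] ]
  end)].

(** * The ordinary Hopf algebra underlying H *)

Section Untwisting.
Variables (K : fieldType) (H : homHopfType K).
Variable alphaHV : H -> H.
Hypotheses (alphaHK : cancel (halpha : H -> H) alphaHV)
           (alphaHVK : cancel alphaHV (halpha : H -> H)).
Implicit Types x y z h : H.

Local Notation "x ** y" := (alphaHV (hmul x y))
  (at level 40, left associativity).
Local Notation udelta h := (hdelta (alphaHV h)).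

Let alphaHVL : linear alphaHV := linear_can alphaHK alphaHVK.

Lemma alphaHVM x y : alphaHV (hmul x y) = hmul (alphaHV x) (alphaHV y).
Proof. by apply: (can_inj alphaHK); rewrite alphaHVK halphaM !alphaHVK. Qed.

(** The map alpha^-1 is comultiplicative because alpha is. *)
Lemma tsum_udelta (V : lmodType K) (f : H -> H -> V) h : bilinear f ->
  tsum (udelta h) f = \sw_(h1, h2 <- hdelta h) f (alphaHV h1) (alphaHV h2).
Proof.
case=> fl fr; rewrite -{2}[h]alphaHVK hdelta_alpha tsum_tsum; last first.
  split=> ? /=; [exact: linear_app (fl _) _ | exact: linear_app (fr _) _].
apply: eq_tsum => h1 h2; rewrite tsum_pure ?alphaHK //.
split=> ? /=; [exact: linear_app (fl _) _ | exact: linear_app (fr _) _].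
Qed.

(** Once alpha^-1 is distributed over products, writing alpha^-1 x as alpha (alpha^-2 x) gives
    exactly the twist that [hmulA] moves to the last factor. *)
Lemma umulA x y z : x ** (y ** z) = x ** y ** z.
Proof. by rewrite !alphaHVM -{1}[alphaHV x]alphaHVK hmulA alphaHVK. Qed.

Lemma umul1 x : hone ** x = x.
Proof. by rewrite hmul1l alphaHK. Qed.

Lemma umulr1 x : x ** hone = x.
Proof. by rewrite hmul1r alphaHK. Qed.

(** Stated against a trilinear F, so that it rewrites directly inside iterated Sweedler sums. *)
Lemma udelta_coassoc (V : lmodType K) (F : H -> H -> H -> V) h :
  (forall x, bilinear (F x)) -> (forall y z, linear (fun x => F x y z)) ->
  \sw_(h1, h2 <- udelta h) \sw_(h11, h12 <- udelta h1) F h11 h12 h2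
  = \sw_(h1, h2 <- udelta h) \sw_(h21, h22 <- udelta h2) F h1 h21 h22.
Proof.
move=> FB F1.
have F2 x z : linear (fun y => F x y z) by case: (FB x) => + _; apply.
have F3 x y : linear (F x y) by case: (FB x) => _; apply.
(* Evaluates F after alpha^-1 on all three legs. Applied to [hcoassoc], it cancels the alpha on the
   outer leg, while on the other two legs alpha^-1 turns [hdelta] into the untwisted coproduct. *)
pose L (s : tensor H (tensor H H)) :=
  \sw_(x, t <- s) \sw_(y, z <- t) F (alphaHV x) (alphaHV y) (alphaHV z).
have G1 y z : linear (fun x => F (alphaHV x) (alphaHV y) (alphaHV z)).
  exact: (linear_app (F1 _ _)).
have G2 x z : linear (fun y => F (alphaHV x) (alphaHV y) (alphaHV z)).
  exact: (linear_app (F2 _ _)).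
have G3 x y : linear (fun z => F (alphaHV x) (alphaHV y) (alphaHV z)).
  exact: (linear_app (F3 _ _)).
have GB x : bilinear (fun y z => F (alphaHV x) (alphaHV y) (alphaHV z)).
  by split=> ? /=.
have GL : bilinear (fun (x : H) (t : tensor H H) =>
    \sw_(y, z <- t) F (alphaHV x) (alphaHV y) (alphaHV z)).
  split=> ? /=; first exact: linear_tsum.
  by apply: linear_tsum_tensor; [exact: GB | multilinear].
have LL : linear L by apply: linear_tsum_tensor; [exact: GL | multilinear].
have := congr1 L (hcoassoc (alphaHV h)).
rewrite !linear_of_tsum // => E; transitivity
  (\sw_(h1, h2 <- udelta h) \sw_(h11, h12 <- hdelta h1)
     F (alphaHV h11) (alphaHV h12) h2).
  by apply: eq_tsum => h1 h2; rewrite tsum_udelta //; split=> ? /=.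
transitivity (\sw_(h1, h2 <- udelta h) L (halpha h1 \ox hdelta h2)).
  rewrite -E; apply: eq_tsum => h1 h2; rewrite linear_of_tsum //.
  by apply: eq_tsum => x y; rewrite /L !tsum_pure // alphaHK.
apply: eq_tsum => h1 h2; rewrite /L tsum_pure // alphaHK.
by rewrite tsum_udelta //; split=> ? /=.
Qed.

Lemma udelta_umul (V : lmodType K) (f : H -> H -> V) x y : bilinear f ->
  tsum (udelta (x ** y)) f =
  \sw_(x1, x2 <- udelta x) \sw_(y1, y2 <- udelta y) f (x1 ** y1) (x2 ** y2).
Proof.
move=> [fl fr].
have aB : bilinear (fun x y => f (alphaHV x) (alphaHV y)).
  split=> ? /=; [exact: linear_app (fl _) _ | exact: linear_app (fr _) _].
rewrite tsum_udelta // alphaHVM hdeltaM tsum_tsum //.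
apply: eq_tsum => x1 x2; rewrite tsum_tsum //.
by apply: eq_tsum => y1 y2; rewrite tsum_pure.
Qed.

Lemma ucounitl (V : lmodType K) (f : H -> V) h : linear f ->
  \sw_(h1, h2 <- udelta h) hcounit h1 *: f h2 = f h.
Proof.
move=> fL; rewrite -[in RHS](alphaHVK h) -hcounitl linear_of_tsum //.
by apply: eq_tsum => h1 h2; rewrite linear_homogeneous.
Qed.

Lemma ucounitr (V : lmodType K) (f : H -> V) h : linear f ->
  \sw_(h1, h2 <- udelta h) hcounit h2 *: f h1 = f h.
Proof.
move=> fL; rewrite -[in RHS](alphaHVK h) -hcounitr linear_of_tsum //.
by apply: eq_tsum => h1 h2; rewrite linear_homogeneous.
Qed.

Lemma alphaHV1 : alphaHV hone = hone.
Proof. by rewrite -{1}halpha1 alphaHK. Qed.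

Lemma hcounit_alphaV h : hcounit (alphaHV h) = hcounit h.
Proof. by rewrite -hcounit_alpha alphaHVK. Qed.

Lemma uantipodel h :
  \sw_(h1, h2 <- udelta h) hantipode h1 ** h2 = hcounit h *: hone.
Proof.
rewrite -linear_of_tsum // hantipodel hcounit_alphaV.
by rewrite linear_homogeneous // alphaHV1.
Qed.

Lemma uantipoder h :
  \sw_(h1, h2 <- udelta h) h1 ** hantipode h2 = hcounit h *: hone.
Proof.
rewrite -linear_of_tsum // hantipoder hcounit_alphaV.
by rewrite linear_homogeneous // alphaHV1.
Qed.

(** * The antipode reverses products *)

Lemma hantipode1 : hantipode hone = hone :> H.
Proof.
have := uantipodel hone; rewrite alphaHV1 hdelta1 tsum_pure;
  last by multilinear.
by rewrite umulr1 hcounit1 scale1r.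
Qed.

Lemma hantipode_alphaV h : hantipode (alphaHV h) = alphaHV (hantipode h).
Proof. by apply: (can_inj alphaHK); rewrite -hantipode_alpha !alphaHVK. Qed.


(** This is the left antipode axiom at x ** y, expanded by multiplicativity of the coproduct. The
    trailing factor z lets it apply inside longer products. *)
Lemma hantipode_umul_cancel x y z :
  \sw_(x1, x2 <- udelta x) \sw_(y1, y2 <- udelta y)
     hantipode (x1 ** y1) ** (x2 ** (y2 ** z))
  = (hcounit x * hcounit y) *: z.
Proof.
have <- : hcounit (x ** y) = hcounit x * hcounit y.
  by rewrite hcounit_alphaV hcounitM.
transitivity (((hcounit (x ** y)) *: hone) ** z); last first.
  by rewrite linearZl_LR linear_homogeneous // umul1.
rewrite -uantipodel udelta_umul; last by multilinear.
rewrite (linear_of_tsum (f := fun u => u ** z)); last by multilinear.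
apply: eq_tsum => x1 x2.
rewrite (linear_of_tsum (f := fun u => u ** z)); last by multilinear.
by apply: eq_tsum => y1 y2; rewrite !umulA.
Qed.

Lemma umul_hantipode_cancel y z :
  \sw_(y1, y2 <- udelta y) y1 ** (hantipode y2 ** z) = hcounit y *: z.
Proof.
transitivity ((hcounit y *: hone) ** z); last first.
  by rewrite linearZl_LR linear_homogeneous // umul1.
rewrite -uantipoder (linear_of_tsum (f := fun u => u ** z)).
  by apply: eq_tsum => y1 y2; rewrite umulA.
by multilinear.
Qed.

(* The sum of S(x1 y1) (x2 (y2 (S(y3) S(x3)))) collapses to either side,     *)
(* both being convolution inverses of the product of H.                      *)
Lemma hantipodeM x y : hantipode (x ** y) = hantipode y ** hantipode x.
Proof.
transitivity (\sw_(x1, x2 <- udelta x) \sw_(x11, x12 <- udelta x1)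
  \sw_(y1, y2 <- udelta y) \sw_(y11, y12 <- udelta y1)
  hantipode (x11 ** y11) ** (x12 ** (y12 ** (hantipode y2 ** hantipode x2)))).
  (* The inner factors y12 ** S(y2) cancel first; the same cancellation then occurs in x. *)
  have E p q r : \sw_(y1, y2 <- udelta y) \sw_(y11, y12 <- udelta y1)
      hantipode (p ** y11) ** (q ** (y12 ** (hantipode y2 ** hantipode r)))
      = hantipode (p ** y) ** (q ** hantipode r).
    rewrite udelta_coassoc; [|by multilinear|by multilinear].
    rewrite -(ucounitr (f := fun u => hantipode (p ** u) ** _)); last first.
      by multilinear.
    apply: eq_tsum => y1 y2.
    rewrite -(linear_of_tsum (f := fun u => hantipode (p ** y1) ** (q ** u)));
      last by multilinear.
    rewrite umul_hantipode_cancel.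
    by rewrite -(linear_homogeneous (f := fun u => _ ** (q ** u))) //;
      multilinear.
  symmetry; under eq_tsum => x1 x2 do under eq_tsum => x11 x12 do rewrite E.
  rewrite udelta_coassoc; [|by multilinear|by multilinear].
  rewrite -[RHS](ucounitr (f := fun u => hantipode (u ** y)));
    last by multilinear.
  apply: eq_tsum => x1 x2.
  rewrite -(linear_of_tsum (f := fun u => hantipode (x1 ** y) ** u));
    last by multilinear.
  by rewrite uantipoder linearZr_LR linear_homogeneous // umulr1.
(* For the other collapse, the sums are reordered so that S(x11 ** y11) meets x12 and y12. *)
rewrite -[RHS](ucounitl (f := fun u => _ ** hantipode u)); last by multilinear.
apply: eq_tsum => x1 x2; rewrite tsum_exchange.
rewrite -[X in _ *: X](ucounitl (f := fun u => hantipode u ** _)); last first.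
  by multilinear.
rewrite (linear_of_tsum (f := fun u => hcounit x1 *: u)); last by multilinear.
apply: eq_tsum => y1 y2.
by rewrite hantipode_umul_cancel scalerA.
Qed.

(** * The inverse antipode as a skew antipode *)

Variable antipodeV : H -> H.
Hypotheses (antipodeK : cancel (hantipode : H -> H) antipodeV)
           (antipodeVK : cancel antipodeV (hantipode : H -> H)).

Let antipodeVL : linear antipodeV := linear_can antipodeK antipodeVK.

Lemma antipodeV_alphaV h : antipodeV (alphaHV h) = alphaHV (antipodeV h).
Proof.
by apply: (can_inj antipodeK); rewrite hantipode_alphaV !antipodeVK.
Qed.

(** Applying S turns S^-1(h2) ** h1 into S(h1) ** h2, the left antipode axiom; [skew_antipoder]
    follows likewise from the right one. *)
Lemma skew_antipodel h :
  \sw_(h1, h2 <- udelta h) antipodeV h2 ** h1 = hcounit h *: hone.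
Proof.
apply: (can_inj antipodeK); rewrite linear_of_tsum; last exact: linearP.
rewrite linearZ /= hantipode1 -uantipodel.
by apply: eq_tsum => h1 h2; rewrite hantipodeM antipodeVK.
Qed.

Lemma skew_antipoder h :
  \sw_(h1, h2 <- udelta h) h2 ** antipodeV h1 = hcounit h *: hone.
Proof.
apply: (can_inj antipodeK); rewrite linear_of_tsum; last exact: linearP.
rewrite linearZ /= hantipode1 -uantipoder.
by apply: eq_tsum => h1 h2; rewrite hantipodeM antipodeVK.
Qed.

(** * The untwisted right module D and the twist maps *)

Variable D : bimodHomAlgType H.
Variable alphaDV : D -> D.
Hypotheses (alphaDK : cancel (halpha : D -> D) alphaDV)
           (alphaDVK : cancel alphaDV (halpha : D -> D)).
Hypothesis ract1 : forall d : D, ract d (hone : H) = halpha d :> D.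

Let alphaDVL : linear alphaDV := linear_can alphaDK alphaDVK.

Local Notation "d <** h" := (alphaDV (ract d h))
  (at level 40, left associativity).

Lemma alphaDV_ract (d : D) h : d <** h = ract (alphaDV d) (alphaHV h).
Proof.
by apply: (can_inj alphaDK); rewrite alphaDVK ract_alpha alphaDVK alphaHVK.
Qed.

Lemma uractA (d : D) x y : d <** x <** y = d <** (x ** y).
Proof.
by rewrite -{1}(alphaHK y) -alphaDV_ract ractA alphaDV_ract alphaDK.
Qed.

Lemma uract1 (d : D) : d <** hone = d.
Proof. by rewrite ract1 alphaDK. Qed.

Definition twist (th : H -> H) (t : tensor D H) : tensor D H :=
  \sw_(d, h <- t) \sw_(h1, h2 <- udelta h) (d <** th h2) \ox h1.

Lemma linear_twist th : linear th -> linear (twist th).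
Proof. by move=> thL; multilinear. Qed.

Lemma twist_tens th d h : linear th ->
  twist th (d \ox h) = \sw_(h1, h2 <- udelta h) (d <** th h2) \ox h1.
Proof. by move=> thL; rewrite /twist tsum_pure //; multilinear. Qed.

(** The map [twist ph] acts first and uses the last leg of the coproduct, so ph stands to the left
    of th in the hypothesis; after coassociativity the hypothesis applies to the last two legs and
    the counit removes what is left. *)
Lemma twist_cancel th ph : linear th -> linear ph ->
  (forall h, \sw_(h1, h2 <- udelta h) ph h2 ** th h1 = hcounit h *: hone) ->
  cancel (twist ph) (twist th).
Proof.
move=> thL phL inv.
pose L t := twist th (twist ph t).
have LL : linear L by apply: linear_app; apply: linear_twist.
apply: (tensor_ext (f := bundle_linear LL) (g := idfun)) => d h /=.
rewrite /L twist_tens // linear_of_tsum; last exact: linear_twist.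
under eq_tsum => h1 h2 do [rewrite twist_tens //;
  under eq_tsum => h11 h12 do rewrite uractA].
rewrite (udelta_coassoc
  (F := fun x y z => (d <** (ph z ** th y)) \ox x)); [|by multilinear..].
rewrite -[RHS](ucounitr (f := fun u => d \ox u)); last by multilinear.
apply: eq_tsum => h1 h2.
rewrite -(linear_of_tsum (f := fun u => (d <** u) \ox h1)); last by multilinear.
rewrite inv (linear_homogeneous (f := fun u => (d <** u) \ox h1)) ?uract1 //.
by multilinear.
Qed.

End Untwisting.

(** * Return to the twisted formulas *)

Theorem proposition4p3 (K : fieldType) (H : homHopfType K)
    (D : bimodHomAlgType H)
    (antipodeV : H -> H)
    (antipodeK : cancel (hantipode : H -> H) antipodeV)
    (antipodeVK : cancel antipodeV (hantipode : H -> H))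
    (alphaHV : H -> H)
    (alphaHK : cancel (halpha : H -> H) alphaHV)
    (alphaHVK : cancel alphaHV (halpha : H -> H))
    (alphaDV : D -> D)
    (alphaDK : cancel (halpha : D -> D) alphaDV)
    (alphaDVK : cancel alphaDV (halpha : D -> D))
    (lact1 : forall d : D, lact (hone : H) d = halpha d :> D)
    (ract1 : forall d : D, ract d (hone : H) = halpha d :> D) :
  exists Q Qinv : {linear tensor D H -> tensor D H},
    [/\ forall (d : D) (h : H),
          Q (d \ox h) =
          \sw_(h1, h2 <- hdelta h)
            (ract (alphaDV d) (alphaHV (alphaHV h2)) : D) \ox alphaHV h1,
        forall (d : D) (h : H),
          Qinv (d \ox h) =
          \sw_(h1, h2 <- hdelta h)
            (ract (alphaDV d) (alphaHV (alphaHV (antipodeV h2))) : D)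
              \ox alphaHV h1,
        bijective Q,
        cancel Q Qinv
      & cancel Qinv Q].
Proof.
have alphaHVL : linear alphaHV := linear_can alphaHK alphaHVK.
have alphaDVL : linear alphaDV := linear_can alphaDK alphaDVK.
have SVL : linear antipodeV := linear_can antipodeK antipodeVK.
have idL : linear (fun h : H => h) by [].
have twistL th (thL : linear th) :=
  linear_twist alphaHK alphaHVK alphaDK alphaDVK thL.
(* One alpha_H^-1 on each leg comes from the untwisted coproduct. The untwisted action adds a second
   one on h2 and the alpha_D^-1 on d. *)
have twistE th d h (thL : linear th) :
    (forall h, th (alphaHV h) = alphaHV (th h)) ->
    twist alphaHV alphaDV th (d \ox h) = \sw_(h1, h2 <- hdelta h)
      (ract (alphaDV d) (alphaHV (alphaHV (th h2))) : D) \ox alphaHV h1.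
  move=> tha; rewrite twist_tens // tsum_udelta //; last by multilinear.
  by apply: eq_tsum => h1 h2; rewrite (alphaDV_ract alphaHVK) // tha.
have QK : cancel (twist alphaHV alphaDV id) (twist alphaHV alphaDV antipodeV).
  by apply: twist_cancel => // h; apply: skew_antipoder.
have QVK : cancel (twist alphaHV alphaDV antipodeV) (twist alphaHV alphaDV id).
  by apply: twist_cancel => // h; apply: skew_antipodel.
exists (bundle_linear (twistL _ idL)), (bundle_linear (twistL _ SVL)).
split=> //=.
- by move=> d h; rewrite twistE.
- move=> d h; rewrite twistE // => x.
  exact: (antipodeV_alphaV alphaHK alphaHVK antipodeK antipodeVK).
- by exists (twist alphaHV alphaDV antipodeV).
Qed.
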